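(* Let $G$ be a second countable locally compact abelian group, $\Lambda\subset G$ a uniform lattice, $\widehat G$ the dual group of $G$, and $\Gamma\subset\widehat G$ the annihilator of $\Lambda$. Let $\Omega\subset\widehat G$ be a measurable set of positive, finite Haar measure and let $\ell$ be a positive integer. If for some $a_1,\dots,a_\ell\in G$ the collection $E_\Lambda(a_1,\dots,a_\ell)=\{e_{a_j+\lambda}: j=1,\dots,\ell,\ \lambda\in\Lambda\}$ (restricted to $\Omega$) is a frame for $L^2(\Omega)$, then $(\Omega,\Gamma)$ is an $m$-subtiling pair of $\widehat G$ for some positive integer $m\le \ell$.
   Context: A uniform lattice is a discrete, co-compact subgroup. The annihilator of $\Lambda$ is $\Gamma=\{\gamma\in\widehat G: e_\lambda(\gamma)=1\ \forall\lambda\in\Lambda\}$, where for $g\in G$ and a character $\omega\in\widehat G$ we write $e_g(\omega)=\omega(g)$. For a lattice $\Gamma\subset\widehat G$ and $\omega\in\widehat G$, set $F_{\Omega,\Gamma}(\omega)=\sum_{\gamma\in\Gamma}\chi_\Omega(\omega+\gamma)$. The pair $(\Omega,\Gamma)$ is an $m$-subtiling pair (sub-multitiling pair) of $\widehat G$ if $\operatorname{ess\,sup}_{\omega\in\widehat G}F_{\Omega,\Gamma}(\omega)=m$. A family $\{\phi_j\}_{j\in J}$ in a Hilbert space $\mathbb H$ is a frame if there are $0<A\le B<\infty$ with $A\|f\|^2\le\sum_j|\langle f,\phi_j\rangle|^2\le B\|f\|^2$ for all $f\in\mathbb H$. *)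

(* Defs.v *)
From HB Require Import structures.
From mathcomp Require Import all_boot all_order all_algebra.
From mathcomp Require Import all_classical all_reals all_analysis.
From mathcomp Require Import ess_sup_inf.
From mathcomp.real_closed Require Import complex.

Set Implicit Arguments.
Unset Strict Implicit.
Unset Printing Implicit Defensive.

Import Order.TTheory GRing.Theory Num.Theory.
Import numFieldNormedType.Exports.

Local Open Scope classical_set_scope.
Local Open Scope ring_scope.

Definition ptd (T : topologicalZmodType) : Type := T.
HB.instance Definition _ (T : topologicalZmodType) := Topological.on (ptd T).
HB.instance Definition _ (T : topologicalZmodType) :=
  isPointed.Build (ptd T) (0 : T).
Definition borelType (T : topologicalZmodType) :=
  @g_sigma_algebraType (ptd T) (@open T).

Section Defs.
Variable R : realType.

Definition cabs (z : R[i]) : R :=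
  Num.sqrt (complex.Re z ^+ 2 + complex.Im z ^+ 2).

Definition sc_LCA_group (G : topologicalZmodType) : Prop :=
  [/\ hausdorff_space G, locally_compact [set: G] & @second_countable G].

(* Uniform lattice: a discrete, co-compact subgroup. Co-compactness of the
   (closed) subgroup L, i.e. compactness of G/L, is expressed as the existence
   of a compact K with K + L = G. *)
Definition uniform_lattice (G : topologicalZmodType) (L : set G) : Prop :=
  [/\ L 0,
      (forall x y, L x -> L y -> L (x - y)),
      (forall x, L x -> exists2 U, nbhs x U & U `&` L = [set x]) &
      (exists2 K : set G, compact K & [set k + l | k in K & l in L] = [set: G])].

Definition continuous_character (G : topologicalZmodType) (chi : G -> R[i]) : Prop :=
  [/\ (forall g, cabs (chi g) = 1),
      (forall g h, chi (g + h) = chi g * chi h),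
      continuous (fun g => complex.Re (chi g)) &
      continuous (fun g => complex.Im (chi g))].

(* e : G -> Gh -> C identifies Gh with the Pontryagin dual of G:
   e g w = w(g) = e_g(w).  w |-> e(.,w) is a group isomorphism from Gh onto
   the group of continuous characters of G, and the topology of Gh is the
   topology of uniform convergence on compact subsets of G (compact-open). *)
Definition pontryagin_dual (G : topologicalZmodType) (Gh : topologicalZmodType)
    (e : G -> Gh -> R[i]) : Prop :=
  [/\ (forall w, continuous_character (fun g => e g w)),
      (forall g w v, e g (w + v) = e g w * e g v),
      (forall chi, continuous_character chi -> exists w, chi = (fun g => e g w)),
      (forall w v, (fun g => e g w) = (fun g => e g v) -> w = v) &
      (forall (F : set_system Gh) (w : Gh), ProperFilter F ->
         (F --> w) <->
         (forall K : set G, compact K -> forall eps : R, 0 < eps ->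
            \forall v \near F, forall g, K g -> cabs (e g v - e g w) < eps))].

Definition haar_measure (Gh : topologicalZmodType)
    (mu : {measure set (borelType Gh) -> \bar R}) : Prop :=
  [/\ (forall (x : Gh) (A : set Gh), measurable (A : set (borelType Gh)) ->
         mu [set x + y | y in A] = mu A),
      (forall K : set Gh, compact K -> (mu K < +oo)%E),
      (forall U : set Gh, open U -> U !=set0 -> (0 < mu U)%E),
      (forall A : set Gh, measurable (A : set (borelType Gh)) ->
         mu A = ereal_inf [set mu U | U in [set U : set Gh | open U /\ A `<=` U]]) &
      (forall U : set Gh, open U ->
         mu U = ereal_sup [set mu K | K in [set K : set Gh | compact K /\ K `<=` U]])].

Definition annihilator (G : topologicalZmodType) (Gh : topologicalZmodType)
    (e : G -> Gh -> R[i]) (L : set G) : set Gh :=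
  [set w | forall l, L l -> e l w = 1].

Section L2.
Context d (T : measurableType d) (mu : {measure set T -> \bar R}) (Om : set T).

Definition sqnormc (z : R[i]) : R := cabs z ^+ 2.

Definition L2_on (f : T -> R[i]) : Prop :=
  [/\ measurable_fun Om (fun w => complex.Re (f w)),
      measurable_fun Om (fun w => complex.Im (f w)) &
      (\int[mu]_(w in Om) (sqnormc (f w))%:E < +oo)%E].

Definition L2_sqnorm (f : T -> R[i]) : \bar R :=
  (\int[mu]_(w in Om) (sqnormc (f w))%:E)%E.

Definition L2_inner (f g : T -> R[i]) : R[i] :=
  Complex (Rintegral mu Om (fun w => complex.Re (f w * conjc (g w))))
          (Rintegral mu Om (fun w => complex.Im (f w * conjc (g w)))).

Definition L2_frame (I : choiceType) (J : set I) (phi : I -> T -> R[i]) : Prop :=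
  exists A B : R, 0 < A <= B /\
    forall f, L2_on f ->
      (A%:E * L2_sqnorm f <= \esum_(j in J) (sqnormc (L2_inner f (phi j)))%:E
       <= B%:E * L2_sqnorm f)%E.
End L2.

Definition F_OmGam (Gh : zmodType) (Om Gam : set Gh) (w : Gh) : \bar R :=
  (\esum_(g in Gam) (\1_Om (w + g) : R)%:E)%E.

Definition subtiling_pair (Gh : topologicalZmodType)
    (mu : {measure set (borelType Gh) -> \bar R})
    (Om Gam : set Gh) (m : nat) : Prop :=
  ess_sup mu (F_OmGam Om Gam) = (m%:R)%:E.

End Defs.

(* Main.v *)
Require Import Defs.
From HB Require Import structures.
From mathcomp Require Import all_boot all_order all_algebra finmap.
From mathcomp Require Import all_classical all_reals all_analysis.
From mathcomp Require Import ess_sup_inf measurable_realfun.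
From mathcomp.real_closed Require Import complex.
From mathcomp Require Import ring lra.
Import Order.TTheory GRing.Theory Num.Theory.
Import numFieldNormedType.Exports.
Local Open Scope classical_set_scope.
Local Open Scope ring_scope.

(* If [l + 1] elements [gam i] of the annihilator translated a common set [D] of
   positive measure into [Om], one could shrink [D] to a set [E] whose translates
   [E + gam i] are disjoint. From [E] to [E + gam i] the function [e_(a_j + lam)]
   only changes by the factor [e_(a_j) (gam i)], which does not depend on [lam];
   so a combination of the [l + 1] indicators of these translates is orthogonal
   to the whole system as soon as its coefficients solve [l] linear equations,
   and a nonzero one contradicts the lower frame bound. As the annihilator is
   countable, [{F_(Om, Gam) > l}] is a countable union of such null sets [D]. *)

Set Implicit Arguments.
Unset Strict Implicit.

(** * Squared moduli and rational boxes in the complex plane *)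

Lemma sqnormcE (R : realType) (z : R[i]) :
  sqnormc z = complex.Re z ^+ 2 + complex.Im z ^+ 2.
Proof. by rewrite /sqnormc /cabs sqr_sqrtr// addr_ge0// sqr_ge0. Qed.

Lemma sqnormcM (R : realType) (z w : R[i]) : sqnormc (z * w) = sqnormc z * sqnormc w.
Proof. by rewrite !sqnormcE; case: z w => [a b] [c d] /=; ring. Qed.

Lemma sqnormc_conj (R : realType) (z : R[i]) : sqnormc (conjc z) = sqnormc z.
Proof. by rewrite !sqnormcE; case: z => a b /=; rewrite sqrrN. Qed.

Lemma sqnormc_ge0 (R : realType) (z : R[i]) : 0 <= sqnormc z.
Proof. by rewrite sqr_ge0. Qed.

Lemma sqnormc_eq0 (R : realType) (z : R[i]) : sqnormc z = 0 -> z = 0.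
Proof.
case: z => a b; rewrite sqnormcE /= => /eqP.
by rewrite paddr_eq0 ?sqr_ge0// !sqrf_eq0 => /andP[/eqP-> /eqP->].
Qed.

Lemma sqnormc_gt0 (R : realType) (z : R[i]) : z != 0 -> 0 < sqnormc z.
Proof. by move=> z0; rewrite lt0r sqnormc_ge0 andbT; apply: contra_neqN z0 => /eqP/sqnormc_eq0. Qed.

Lemma le_Re_cabs (R : realType) (z : R[i]) : `|complex.Re z| <= cabs z.
Proof. by rewrite -sqrtr_sqr ler_sqrt ?addr_ge0 ?sqr_ge0// lerDl sqr_ge0. Qed.

Lemma le_Im_cabs (R : realType) (z : R[i]) : `|complex.Im z| <= cabs z.
Proof. by rewrite -sqrtr_sqr ler_sqrt ?addr_ge0 ?sqr_ge0// lerDr sqr_ge0. Qed.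

Lemma rat_approx (R : realType) (x r : R) : 0 < r -> exists q : rat, `|x - ratr q| < r.
Proof.
move=> r0; have [|q] := @rat_in_itvoo _ (x - r) (x + r).
  by rewrite ltrBlDr -addrA ltrDl addr_gt0.
by rewrite in_itv/= => /andP[? ?]; exists q; rewrite ltr_norml; apply/andP; split; lra.
Qed.

(** An open square of half-side [r] with a rational centre. For fixed [r > 0] these countably many
    squares cover the plane, which serves both to code characters by countable data and to select a
    piece of positive measure. *)
Definition rat_box (R : realType) (r : R) (q : rat * rat) : set R[i] :=
  [set z | `|complex.Re z - ratr q.1| < r /\ `|complex.Im z - ratr q.2| < r].

Lemma rat_box_cover (R : realType) (r : R) (z : R[i]) : 0 < r -> exists q, rat_box r q z.
Proof.
move=> r0; have [p ?] := rat_approx (complex.Re z) r0.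
by have [q ?] := rat_approx (complex.Im z) r0; exists (p, q).
Qed.

Lemma rat_box_sqnormc (R : realType) (r : R) q (z w : R[i]) :
  rat_box r q z -> rat_box r q w -> sqnormc (z - w) < 8 * r ^+ 2.
Proof.
move=> [/= /ltr_normlP[a1 a2] /ltr_normlP[b1 b2]] [/= /ltr_normlP[c1 c2] /ltr_normlP[d1 d2]].
rewrite sqnormcE; case: z w a1 a2 b1 b2 c1 c2 d1 d2 => [a b] [c d] /= *.
have h1 : (a - c) ^+ 2 < (2 * r) ^+ 2 by nra.
have h2 : (b - d) ^+ 2 < (2 * r) ^+ 2 by nra.
nra.
Qed.

Lemma Re_sum (R : realType) (I : Type) (s : seq I) (F : I -> R[i]) :
  complex.Re (\sum_(i <- s) F i) = \sum_(i <- s) complex.Re (F i).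
Proof. by elim: s => [|i s IH]; rewrite ?big_nil// !big_cons -IH; case: (F i) => ? ?; case: (\sum_(_ <- _) _). Qed.

Lemma Im_sum (R : realType) (I : Type) (s : seq I) (F : I -> R[i]) :
  complex.Im (\sum_(i <- s) F i) = \sum_(i <- s) complex.Im (F i).
Proof. by elim: s => [|i s IH]; rewrite ?big_nil// !big_cons -IH; case: (F i) => ? ?; case: (\sum_(_ <- _) _). Qed.

(* [1 - Re (z ^ 2) = 2 (1 - Re z) (1 + Re z) >= 3 (1 - Re z)] on the arc
   [1 / 2 <= Re z], so repeated doubling of [g] would drive [chi g] out of it. *)
Lemma no_small_character (R : realType) (G : zmodType) (chi : G -> R[i]) :
  (forall g, cabs (chi g) = 1) -> (forall g h, chi (g + h) = chi g * chi h) ->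
  (forall g, 2^-1 <= complex.Re (chi g)) -> forall g, chi g = 1.
Proof.
move=> chi1 chiD chi_arc.
have norm1 g : complex.Re (chi g) ^+ 2 + complex.Im (chi g) ^+ 2 = 1.
  by rewrite -sqnormcE /sqnormc chi1 expr1n.
(* Induction on [n]: the bound at [g + g] gives [3 * n * (1 - Re (chi g)) <= 1], and
   [n + 1 <= 3 * n] once [n >= 1]. The passage from 0 to 1 uses [Re (chi g) >= 1 / 2] directly. *)
have step n : forall g, (1 - complex.Re (chi g)) * n%:R <= 1.
  elim: n => [|n IH] g; first by rewrite mulr0.
  have := IH (g + g); have := chi_arc g; have := norm1 g; rewrite chiD.
  case: (chi g) => x y /= xy x2; rewrite -natr1.
  have n0 : (0 : R) <= n%:R by [].
  have -> : y * y = 1 - x ^+ 2 by rewrite -xy; ring.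
  case: n IH n0 => [_ _ _|n _ n0]; first by lra.
  have : (1 : R) <= n.+1%:R by rewrite ler1n.
  have x1 : x <= 1 by nra.
  move: n0; set m : R := n.+1%:R => m0 m1.
  have : (1 - x) * (x - 2^-1) * m >= 0 by rewrite !mulr_ge0// ?subr_ge0.
  nra.
move=> g; have := norm1 g.
have : 1 - complex.Re (chi g) <= 0.
  rewrite leNgt; apply/negP => h.
  have := step (Num.bound (1 - complex.Re (chi g))^-1) g.
  rewrite leNgt => /negP; apply; rewrite -ltr_pdivrMl// mulr1.
  by apply: archi_boundP; rewrite invr_ge0 ltW.
case: (chi g) => x y /= x_ge1 xy.
have x1 : x = 1 by apply/eqP; rewrite eq_le; apply/andP; split; nra.
move: xy; rewrite x1 expr1n -[RHS]addr0 => /addrI/eqP.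
by rewrite sqrf_eq0 => /eqP->.
Qed.

(** * Characters on the dual group and countability of the annihilator *)

Lemma open_rat_box (R : realType) (T : topologicalType) (f : T -> R[i]) (r : R) q :
  continuous (fun x => complex.Re (f x)) -> continuous (fun x => complex.Im (f x)) ->
  open (f @^-1` rat_box r q).
Proof.
move=> cRe cIm.
have op (h : T -> R) (a : R) : continuous h -> open [set x | `|h x - a| < r].
  move=> ch; rewrite (_ : mkset _ = h @^-1` ball a r).
    by apply: open_comp; [move=> ? _; exact: ch|exact: ball_open].
  by apply/seteqP; split=> x /=; rewrite -ball_normE/= distrC.
have -> : f @^-1` rat_box r q =
    [set x | `|complex.Re (f x) - ratr q.1| < r] `&` [set x | `|complex.Im (f x) - ratr q.2| < r].
  by [].
by apply: openI; exact: op.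
Qed.

(** The convergence clause of [pontryagin_dual], applied to the neighbourhood filter of [w] and the
    compact set [[set g]], makes [e g v] close to [e g w]. *)
Lemma dual_continuous (R : realType) (G Gh : topologicalZmodType) (e : G -> Gh -> R[i]) g :
  pontryagin_dual e ->
  continuous (fun w => complex.Re (e g w)) /\ continuous (fun w => complex.Im (e g w)).
Proof.
move=> [_ _ _ _ etop].
have near_e w (eps : R) : 0 < eps -> \forall v \near w, cabs (e g v - e g w) < eps.
  move=> eps0; have [/(_ _ [set g] _ _ eps0) + _] := etop (nbhs w) w _.
  by move=> /(_ (fun _ => id) (@compact_set1 _ g)); apply: filterS => v; exact.
split=> w; apply/cvgrPdist_lt => eps /(near_e w); apply: filterS => v /=; apply: le_lt_trans.
  by rewrite distrC; have := le_Re_cabs (e g v - e g w); case: (e g v) (e g w) => [? ?] [].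
by rewrite distrC; have := le_Im_cabs (e g v - e g w); case: (e g v) (e g w) => [? ?] [].
Qed.

Lemma dual_sqnormc (R : realType) (G Gh : topologicalZmodType) (e : G -> Gh -> R[i]) g w :
  pontryagin_dual e -> sqnormc (e g w) = 1.
Proof. by move=> [/(_ w)[h _ _ _] _ _ _ _]; rewrite /sqnormc h expr1n. Qed.

Lemma dual_neq0 (R : realType) (G Gh : topologicalZmodType) (e : G -> Gh -> R[i]) g w :
  pontryagin_dual e -> e g w != 0.
Proof.
move=> pe; apply/eqP => h; have := dual_sqnormc g w pe.
by rewrite h sqnormcE /= !expr0n /= addr0 => /eqP; rewrite eq_sym oner_eq0.
Qed.

Lemma dual0 (R : realType) (G Gh : topologicalZmodType) (e : G -> Gh -> R[i]) g :
  pontryagin_dual e -> e g 0 = 1.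
Proof.
move=> pe; have [_ eD _ _ _] := pe; apply: (mulfI (dual_neq0 g 0 pe)).
by rewrite -eD addr0 mulr1.
Qed.

Lemma dual_trivial (R : realType) (G Gh : topologicalZmodType) (e : G -> Gh -> R[i]) w :
  pontryagin_dual e -> (forall g, e g w = 1) -> w = 0.
Proof.
move=> pe w1; have [_ _ _ einj _] := pe; apply: einj; apply/funext => g.
by rewrite w1 dual0.
Qed.

Lemma annihilatorB (R : realType) (G Gh : topologicalZmodType) (e : G -> Gh -> R[i]) (L : set G) v w :
  pontryagin_dual e -> annihilator e L v -> annihilator e L w -> annihilator e L (v - w).
Proof.
move=> [_ eD _ _ _] Lv Lw g Lg; have := eD g (v - w) w.
by rewrite subrK (Lv g Lg) (Lw g Lg) mulr1.
Qed.

(* Two elements of the annihilator that are uniformly close on the compact [K]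
   are uniformly close on [G = K + L], hence equal; and up to such closeness a
   function on [K] is described by finitely many basic open sets. *)
Lemma annihilator_countable (R : realType) (G Gh : topologicalZmodType)
    (e : G -> Gh -> R[i]) (L : set G) :
  @second_countable G -> pontryagin_dual e -> uniform_lattice L ->
  countable (annihilator e L).
Proof.
move=> [B Bcnt [Bopen Bbasis]] pe [_ _ _ [K Kcpt KL]].
have [echar eD _ _ _] := pe.
(* Here [p.1] is a basic open set of [G] on which [e^~ w] takes its values in the box of half-side
   1/4 centred at [p.2]. *)
pose good w (p : set G * (rat * rat)) := B p.1 /\ p.1 `<=` (e^~ w) @^-1` rat_box 4^-1 p.2.
have cover w : exists D : set (set G * (rat * rat)),
    [/\ finite_set D, D `<=` good w & K `<=` \bigcup_(p in D) p.1].
  have [] : finite_subset_cover (good w) (@fst (set G) (rat * rat)) K.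
    have := Kcpt : @compact (ptd G) K.
    rewrite compact_cover; apply; first by move=> p [/Bopen].
    move=> g Kg; have [|q gq] := @rat_box_cover R 4^-1 (e g w); first by rewrite invr_gt0.
    have [_ _ cRe cIm] := echar w.
    have /(Bbasis g) [U [BU Ug] Uq] : nbhs g ((e^~ w) @^-1` rat_box 4^-1 q).
      by apply: open_nbhs_nbhs; split => //; exact: open_rat_box.
    by exists (U, q).
  move=> D DG KD; exists [set` D]; split=> //.
  by move=> p /DG /set_mem.
(* [Phi w] is a finite code of [w] over the countable set of pairs; it remains to see that it
   determines [w] within the annihilator. *)
have [Phi PhiP] := choice cover.
have /countable_injP[h hinj] : countable
    [set D : set (set G * (rat * rat)) | D `<=` B `*` setT /\ finite_set D].
  by apply: countable_finite_subset; apply: countableX => //; exact: countableP.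
apply/countable_injP; exists (h \o Phi) => v w; rewrite !inE => Lv Lw /= Phivw.
have PhiI u : Phi u \in [set D | D `<=` B `*` setT /\ finite_set D].
  by rewrite inE; have [fD DG _] := PhiP u; split=> // p /DG[].
have {}Phivw := hinj _ _ (PhiI _) (PhiI _) Phivw.
apply/subr0_eq; apply: (dual_trivial pe).
have [chi1 chiD _ _] := echar (v - w).
apply: no_small_character => // g.
have [k Kk [l Ll <-]] : [set k + l | k in K & l in L] g by rewrite KL.
rewrite chiD (annihilatorB pe Lv Lw Ll) mulr1.
have [_ Dv KDv] := PhiP v; have [_ Dw _] := PhiP w.
have [p Dp pk] := KDv k Kk.
(* Two values in one box are at squared distance below [8 / 16 = 1 / 2]. For [z = e k (v - w)] of
   modulus 1 this reads [2 - 2 * Re z < 1 / 2], so [Re z > 3 / 4]. *)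
have := rat_box_sqnormc ((Dv p Dp).2 k pk) ((Dw p _).2 k pk).
rewrite -Phivw => /(_ Dp) /=.
have -> : e k v - e k w = (e k (v - w) - 1) * e k w.
  by rewrite mulrBl mul1r -eD subrK.
rewrite sqnormcM dual_sqnormc// mulr1.
have := dual_sqnormc k (v - w) pe.
rewrite !sqnormcE; case: (e k (v - w)) => x y /= xy; rewrite subr0 => h1.
by nra.
Qed.

(** * Borel measurability, null sets and sets avoiding given translations *)

Lemma open_borel (T : topologicalZmodType) (U : set T) :
  open U -> measurable (U : set (borelType T)).
Proof. by move=> oU; apply: sub_sigma_algebra. Qed.

Lemma continuous_borel_measurable (R : realType) (T : topologicalZmodType) (f : T -> R) :
  continuous f -> measurable_fun [set: borelType T] f.
Proof.
move=> cf; apply: (measurability _ (measurable_realfun.RGenOInfty.measurableE R)) => //.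
move=> _ [_ [a ->] <-]; rewrite setTI; apply: open_borel.
by apply: open_comp => [? _|]; [exact: cf|rewrite set_itvE; exact: open_gt].
Qed.

Lemma continuous_translate (T : topologicalZmodType) (x : T) : continuous (fun w => w + x).
Proof.
move=> w; apply: (@continuous_comp _ _ _ (fun w => (w, x)) (fun p : T * T => p.1 + p.2)).
  by apply: cvg_pair => /=; [exact: cvg_id|exact: cvg_cst].
exact: add_continuous.
Qed.

Lemma measurable_translate (T : topologicalZmodType) (x : T) :
  measurable_fun [set: borelType T] (fun w : borelType T => (w : T) + x : borelType T).
Proof.
apply: (@measurability _ _ (borelType T) (borelType T) setT _ (@open T)) => // _ [U oU <-]; rewrite setTI; apply: open_borel.
by apply: open_comp => // ? _; exact: continuous_translate.
Qed.

Lemma negligible_countable_cover d (T : measurableType d) (R : realType)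
    (mu : {measure set T -> \bar R}) (I : countType) (A : I -> set T) (D : set T) :
  (forall i, mu.-negligible (A i)) -> D `<=` \bigcup_i A i -> mu.-negligible D.
Proof.
move=> A0 DA.
(* The family is re-indexed by natural numbers; a number that codes no index gets the empty set. *)
pose F k : set T := if choice.unpickle k is Some i then A i else set0.
apply: (@negligibleS _ _ _ mu (\bigcup_k F k)).
  by move=> w /DA[i _ Aw]; exists (choice.pickle i) => //; rewrite /F choice.pickleK.
apply: negligible_bigcup => k; rewrite /F; case: choice.unpickle => [i|].
  exact: A0.
exact: negligible_set0.
Qed.

(* For [d != 0] some character takes distinct values at [w] and [w + d] for
   every [w], by a uniform margin, so that a small box of its values contains
   at most one of the two. *)
Lemma avoid_translates (R : realType) (G Gh : topologicalZmodType) (e : G -> Gh -> R[i])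
    (mu : {measure set (borelType Gh) -> \bar R}) (s : seq Gh) (D : set (borelType Gh)) :
  pontryagin_dual e -> 0 \notin s -> measurable D -> (0 < mu D)%E ->
  exists E : set (borelType Gh), [/\ measurable E, E `<=` D, (0 < mu E)%E &
    forall d, d \in s -> forall w : Gh, E w -> ~ E (w + d)].
Proof.
move=> pe + mD D0; elim: s => [|d s IH]; first by exists D; split.
rewrite inE negb_or => /andP[d0 /IH [E [mE ED E0 Es]]].
have [g gd] : exists g, e g d != 1.
  apply: contrapT => /forallNP ge; move/eqP: d0; apply; apply/esym.
  by apply: (dual_trivial pe) => g; apply/eqP/negPn/negP/ge.
have [cRe cIm] := dual_continuous g pe.
(* With this radius, points of a common box are at squared distance below [8 * r ^+ 2], half of
   [sqnormc (e g d - 1)], which is the exact squared distance between the values at [w] and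
   [w + d]. *)
pose r := cabs (e g d - 1) / 4.
have n0 : 0 < sqnormc (e g d - 1) by rewrite sqnormc_gt0// subr_eq0.
have r0 : 0 < r.
  by rewrite divr_gt0// lt0r sqrtr_ge0 andbT; apply: contraTneq n0; rewrite /sqnormc => ->; rewrite expr0n ltxx.
have mbox q : measurable (((e g) @^-1` rat_box r q : set Gh) : set (borelType Gh)).
  by apply: open_borel; exact: open_rat_box.
have [q q0] : exists q, (0 < mu (E `&` (e g) @^-1` rat_box r q))%E.
  apply: contrapT => /forallNP null; move: E0; rewrite lt0e => /andP[/eqP + _]; apply.
  apply/negligibleP => //.
  apply: (@negligible_countable_cover _ _ _ _ _ (fun q => E `&` (e g) @^-1` rat_box r q)).
    move=> q; apply/negligibleP; first exact: measurableI.
    by apply/eqP; rewrite -measure_le0 leNgt; exact/negP/null.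
  by move=> w Ew; have [q] := rat_box_cover (e g w) r0; exists q.
exists (E `&` (e g) @^-1` rat_box r q); split => //.
- exact: measurableI.
- by move=> w [/ED].
move=> d'; rewrite inE => /predU1P[->|d's] w [Ew bw] [Ed bd]; last exact: (Es d' d's w Ew Ed).
have := rat_box_sqnormc bd bw.
have -> : e g (w + d) - e g w = e g w * (e g d - 1).
  by have [_ -> _ _ _] := pe; rewrite mulrBr mulr1.
rewrite sqnormcM dual_sqnormc// mul1r.
have -> : 8 * r ^+ 2 = sqnormc (e g d - 1) / 2 by rewrite /r /sqnormc; field.
lra.
Qed.

(** * Integration of complex-valued functions *)

(** Defined componentwise as in [L2_inner], so that [L2_inner mu Om f g] unfolds to the integral of
    [f] times the conjugate of [g]. *)
Definition cint d (T : measurableType d) (R : realType) (mu : {measure set T -> \bar R})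
    (D : set T) (h : T -> R[i]) : R[i] :=
  Complex (Rintegral mu D (fun w => complex.Re (h w)))
          (Rintegral mu D (fun w => complex.Im (h w))).

Definition cintegrable d (T : measurableType d) (R : realType)
    (mu : {measure set T -> \bar R}) (D : set T) (h : T -> R[i]) : Prop :=
  mu.-integrable D (fun w => (complex.Re (h w))%:E) /\
  mu.-integrable D (fun w => (complex.Im (h w))%:E).

Lemma cintegrableD d (T : measurableType d) (R : realType)
    (mu : {measure set T -> \bar R}) (D : set T) (f g : T -> R[i]) :
  measurable D -> cintegrable mu D f -> cintegrable mu D g ->
  cintegrable mu D (fun w => f w + g w).
Proof.
move=> mD [f1 f2] [g1 g2]; split.
  apply: eq_integrable (integrableD mD f1 g1) => // w _ /=.
  by rewrite -EFinD; case: (f w) (g w) => [? ?] [].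
apply: eq_integrable (integrableD mD f2 g2) => // w _ /=.
by rewrite -EFinD; case: (f w) (g w) => [? ?] [].
Qed.

Lemma cintD d (T : measurableType d) (R : realType)
    (mu : {measure set T -> \bar R}) (D : set T) (f g : T -> R[i]) :
  measurable D -> cintegrable mu D f -> cintegrable mu D g ->
  cint mu D (fun w => f w + g w) = cint mu D f + cint mu D g.
Proof.
move=> mD [f1 f2] [g1 g2]; rewrite /cint [RHS]/GRing.add/= -!RintegralD//.
by congr Complex; apply: eq_Rintegral => w _; case: (f w) (g w) => [? ?] [].
Qed.

Lemma cintegrableZ d (T : measurableType d) (R : realType)
    (mu : {measure set T -> \bar R}) (D : set T) (c : R[i]) (f : T -> R[i]) :
  measurable D -> cintegrable mu D f -> cintegrable mu D (fun w => c * f w).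
Proof.
move=> mD [f1 f2]; case: c => a b; split.
  apply: eq_integrable (integrableB mD (integrableZl mD a f1) (integrableZl mD b f2)) => // w _ /=.
  by rewrite -!EFinM -EFinB; case: (f w).
apply: eq_integrable (integrableD mD (integrableZl mD a f2) (integrableZl mD b f1)) => // w _ /=.
by rewrite -!EFinM -EFinD; case: (f w).
Qed.

Lemma cintZ d (T : measurableType d) (R : realType)
    (mu : {measure set T -> \bar R}) (D : set T) (c : R[i]) (f : T -> R[i]) :
  measurable D -> cintegrable mu D f ->
  cint mu D (fun w => c * f w) = c * cint mu D f.
Proof.
move=> mD [f1 f2]; case: c => a b; rewrite /cint [RHS]/GRing.mul/= -!RintegralZl//.
rewrite -RintegralB//; [|exact: (integrableZl mD a f1)|exact: (integrableZl mD b f2)].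
rewrite -RintegralD//; [|exact: (integrableZl mD a f2)|exact: (integrableZl mD b f1)].
by congr Complex; apply: eq_Rintegral => w _; case: (f w).
Qed.

(** Both claims go through one induction, since additivity of the integral at each step requires
    integrability of the remaining sum. *)
Lemma cint_sum d (T : measurableType d) (R : realType)
    (mu : {measure set T -> \bar R}) (D : set T) (I : Type) (s : seq I) (f : I -> T -> R[i]) :
  measurable D -> (forall i, cintegrable mu D (f i)) ->
  cintegrable mu D (fun w => \sum_(i <- s) f i w) /\
  cint mu D (fun w => \sum_(i <- s) f i w) = \sum_(i <- s) cint mu D (f i).
Proof.
move=> mD fint; elim: s => [|i s [IH1 IH2]].
  rewrite (_ : (fun w => \sum_(i <- [::]) f i w) = (fun=> 0)); last first.
    by apply/funext => w; rewrite big_nil.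
  rewrite big_nil; split; first by split; exact: integrable0.
  by rewrite /cint /= Rintegral_cst// mul0r.
rewrite (_ : (fun w => \sum_(j <- i :: s) f j w) = (fun w => f i w + \sum_(j <- s) f j w)); last first.
  by apply/funext => w; rewrite big_cons.
split; first exact: cintegrableD.
by rewrite big_cons cintD// IH2.
Qed.

Lemma cint_indic d (T : measurableType d) (R : realType)
    (mu : {measure set T -> \bar R}) (D E : set T) (h : T -> R[i]) :
  E `<=` D ->
  cint mu D (fun w => (\1_E w)%:C%C * h w) = cint mu E h.
Proof.
move=> ED; have -> : cint mu E h = cint mu (D `&` E) h by rewrite setIidr.
rewrite /cint !Rintegral_mkcondr.
by congr Complex; apply: eq_Rintegral => w _; rewrite /patch indicE;
  case: (h w) => a b /=; case: (w \in E); rewrite /= ?(mul0r, mul1r, subr0, addr0).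
Qed.

Lemma cintegrable_bounded d (T : measurableType d) (R : realType)
    (mu : {measure set T -> \bar R}) (D : set T) (h : T -> R[i]) :
  measurable D -> (mu D < +oo)%E ->
  measurable_fun D (fun w => complex.Re (h w)) -> measurable_fun D (fun w => complex.Im (h w)) ->
  (forall w, sqnormc (h w) <= 1) -> cintegrable mu D h.
Proof.
move=> mD Doo mRe mIm h1; split; apply: measurable_bounded_integrable => //;
  exists 1; split => // M M1 w _ /=; apply: le_trans (ltW M1);
  rewrite -[leRHS]sqrtr1 -sqrtr_sqr ler_wsqrtr//; apply: le_trans (h1 w);
  by rewrite sqnormcE ?lerDl ?lerDr sqr_ge0.
Qed.

(** * Translation invariance, and the linear algebra of the coefficients *)

Lemma haar_translate (R : realType) (T : topologicalZmodType)
    (mu : {measure set (borelType T) -> \bar R}) (x : T) (A : set T) :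
  haar_measure mu -> measurable (A : set (borelType T)) ->
  mu [set w | A (w + x)] = mu A.
Proof.
move=> [+ _ _ _ _] mA => /(_ (- x) A mA) <-; congr (mu _).
apply/seteqP; split=> [w /= Aw|_ [y Ay <-]]; first by exists (w + x) => //; rewrite addrC addrK.
by rewrite /= addrC addrA subrr add0r.
Qed.

(** Invariance makes [mu] its own pushforward under translation by [x], and the preimage of the
    translated set is [E]; the rest is change of variables. *)
Lemma Rintegral_translate (R : realType) (T : topologicalZmodType)
    (mu : {measure set (borelType T) -> \bar R}) (x : T) (E : set T) (f : T -> R) :
  haar_measure mu -> measurable (E : set (borelType T)) ->
  measurable_fun [set: borelType T] f ->
  mu.-integrable (E : set (borelType T)) (fun w => (f (w + x))%:E) ->
  Rintegral mu ([set w | E (w - x)] : set (borelType T)) f =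
  Rintegral mu (E : set (borelType T)) (fun w => f (w + x)).
Proof.
move=> hmu mE mf fint; rewrite /Rintegral; congr fine.
pose tau (w : borelType T) : borelType T := (w : T) + x.
have mtau : measurable_fun [set: borelType T] tau by exact: measurable_translate.
have tauE : tau @^-1` [set w | E (w - x)] = E.
  by apply/seteqP; split=> w; rewrite /tau /= addrK.
have mEx : measurable ([set w | E (w - x)] : set (borelType T)).
  by rewrite -[X in measurable X]setTI; exact: measurable_translate.
have := @integral_pushforward _ _ _ _ R _ mtau mu [set w | E (w - x)] (EFin \o f).
rewrite tauE => <- //; last exact/measurable_EFinP.
apply: eq_measure_integral => A mA _; rewrite /pushforward /=.
by rewrite -[LHS](haar_translate x hmu).
Qed.

(** The rank of [M] is at most [l], less than its number [l.+1] of rows. *)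
Lemma left_kernel_wide (F : fieldType) (l : nat) (M : 'M[F]_(l.+1, l)) :
  exists2 c : 'rV[F]_l.+1, c != 0 & c *m M = 0.
Proof.
have : kermx M != 0.
  by rewrite kermx_eq0 /row_free neq_ltn ltnS rank_leq_col.
by case/rowV0Pn => c /sub_kermxP cM c0; exists c.
Qed.

(** Substitute [w + x] for [w] and use that the conjugate of [e g] is multiplicative. *)
Lemma cint_character_translate (R : realType) (G Gh : topologicalZmodType) (e : G -> Gh -> R[i])
    (mu : {measure set (borelType Gh) -> \bar R}) (E : set Gh) (g : G) (x : Gh) :
  pontryagin_dual e -> haar_measure mu -> measurable (E : set (borelType Gh)) -> (mu E < +oo)%E ->
  cint mu ([set w | E (w - x)] : set (borelType Gh)) (fun w => conjc (e g w)) =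
  conjc (e g x) * cint mu (E : set (borelType Gh)) (fun w => conjc (e g w)).
Proof.
move=> pe hmu mE Eoo.
have [cRe cIm] := dual_continuous g pe.
have ReE w : complex.Re (conjc (e g w)) = complex.Re (e g w) by case: (e g w).
have ImE w : complex.Im (conjc (e g w)) = - complex.Im (e g w) by case: (e g w).
have mRe : measurable_fun [set: borelType Gh] (fun w => complex.Re (conjc (e g w))).
  by under eq_fun do rewrite ReE; exact: continuous_borel_measurable.
have mIm : measurable_fun [set: borelType Gh] (fun w => complex.Im (conjc (e g w))).
  under eq_fun do rewrite ImE.
  by apply: measurable_funN; exact: continuous_borel_measurable.
have h1 w : sqnormc (conjc (e g w)) <= 1 by rewrite sqnormc_conj dual_sqnormc.
have cE : cintegrable mu (E : set (borelType Gh)) (fun w => conjc (e g w)).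
  by apply: cintegrable_bounded => //; apply: measurable_funTS.
have eD w : conjc (e g (w + x)) = conjc (e g x) * conjc (e g w).
  by have [_ -> _ _ _] := pe; rewrite rmorphM mulrC.
have [iRe iIm] := cintegrableZ (conjc (e g x)) mE cE.
rewrite -cintZ// /cint !Rintegral_translate//.
- by congr Complex; apply: eq_Rintegral => w _; rewrite eD.
- by under eq_fun do rewrite eD.
- by under eq_fun do rewrite eD.
Qed.

(** * Combinations of indicators of translates *)

(** The set [[set v | E (v - gam i)]] is the translate [E + gam i]. This is the test function for
    the lower frame bound. *)
Definition sum_translates (R : realType) (T : zmodType) (E : set T) (n : nat)
    (gam : 'I_n -> T) (c : 'I_n -> R[i]) (w : T) : R[i] :=
  \sum_(i < n) c i * (\1_[set v | E (v - gam i)] w)%:C%C.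

Section sum_translates.
Context (R : realType) (G Gh : topologicalZmodType) (e : G -> Gh -> R[i]).
Context (mu : {measure set (borelType Gh) -> \bar R}).
Context (n : nat) (gam : 'I_n -> Gh) (Om E : set Gh) (c : 'I_n -> R[i]).
Hypothesis pe : pontryagin_dual e.
Hypothesis hmu : haar_measure mu.
Hypothesis mE : measurable (E : set (borelType Gh)).
Hypothesis mOm : measurable (Om : set (borelType Gh)).
Hypothesis Omoo : (mu Om < +oo)%E.
Hypothesis E_Om : forall i w, E w -> Om (w + gam i).

Let Ei i : set Gh := [set w | E (w - gam i)].

Let f := sum_translates E gam c.

Let mEi i : measurable (Ei i : set (borelType Gh)).
Proof. by rewrite -[X in measurable X]setTI; exact: measurable_translate. Qed.

Let muEi i : mu (Ei i) = mu E.
Proof. exact: haar_translate. Qed.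

Let EiOm i : Ei i `<=` Om.
Proof. by move=> w /(E_Om i); rewrite subrK. Qed.

(** The inner product splits over the translates, and moving the [i]-th one back to [E] costs the
    factor [conjc (e g (gam i))]. The integral over [E] factors out, leaving a single linear form in
    [c]. *)
Lemma L2_inner_sum_translates (g : G) : (mu E < +oo)%E ->
  L2_inner mu Om f (e g) =
  (\sum_(i < n) c i * conjc (e g (gam i))) * cint mu (E : set (borelType Gh)) (fun w => conjc (e g w)).
Proof.
move=> Eoo.
pose h i (w : borelType Gh) := (\1_(Ei i) w)%:C%C * conjc (e g w).
have ih i : cintegrable mu (Om : set (borelType Gh)) (h i).
  have [cRe cIm] := dual_continuous g pe.
  apply: cintegrable_bounded => //.
  - under eq_fun => w.
      rewrite (_ : complex.Re (h i w) = \1_(Ei i) w * complex.Re (e g w)); last first.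
        by rewrite /h; case: (e g w) => p q /=; rewrite mul0r subr0.
      over.
    by apply: measurable_funTS; apply: measurable_funM => //; exact: continuous_borel_measurable.
  - under eq_fun => w.
      rewrite (_ : complex.Im (h i w) = \1_(Ei i) w * - complex.Im (e g w)); last first.
        by rewrite /h; case: (e g w) => p q /=; rewrite mul0r addr0.
      over.
    apply: measurable_funTS; apply: measurable_funM => //.
    by apply: measurable_funN; exact: continuous_borel_measurable.
  move=> w; rewrite /h sqnormcM sqnormc_conj dual_sqnormc// mulr1 sqnormcE indicE.
  by case: (w \in Ei i); rewrite /= !expr0n ?expr1n /= addr0 ?ler01.
have -> : L2_inner mu Om f (e g) = cint mu (Om : set (borelType Gh)) (fun w => \sum_(i < n) c i * h i w).
  rewrite /L2_inner -/(cint mu (Om : set (borelType Gh)) (fun w => f w * conjc (e g w))).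
  congr cint; apply/funext => w; rewrite /f /sum_translates mulr_suml; apply: eq_bigr => i _.
  by rewrite /h mulrA.
have [|_ ->] := @cint_sum _ _ _ mu _ _ (index_enum 'I_n) (fun i w => c i * h i w) mOm.
  by move=> i; exact: cintegrableZ.
rewrite mulr_suml; apply: eq_bigr => i _.
rewrite cintZ// /h cint_indic; last exact: EiOm.
by rewrite (cint_character_translate g (gam i) pe hmu mE Eoo) mulrA.
Qed.

(** Disjointness of the translates in the form supplied by [avoid_translates]: if [w] and
    [w + (gam i - gam j)] were both in [E], then [w + gam i] would lie in [Ei i] and in [Ei j]. *)
Hypothesis E_disj : forall i j, i != j -> forall w, E w -> ~ E (w + (gam i - gam j)).

Let f_Ei i w : Ei i w -> f w = c i.
Proof.
move=> Eiw; rewrite /f /sum_translates (bigD1 i)//= indicE mem_set// mulr1 big1 ?addr0// => j ji.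
rewrite indicE memNset ?mulr0// => Ejw.
have /E_disj : i != j by rewrite eq_sym.
by apply; first exact: Eiw; rewrite addrA subrK.
Qed.

(** On each translate [f] equals one coefficient, and it vanishes off all of them, so its squared
    modulus is at most the sum of all [sqnormc (c i)], a constant on a set of finite measure. *)
Lemma L2_on_sum_translates : L2_on mu Om f.
Proof.
have mRe : measurable_fun (Om : set (borelType Gh)) (fun w => complex.Re (f w)).
  under eq_fun => w.
    rewrite /f /sum_translates Re_sum; under eq_bigr => i _.
      rewrite (_ : complex.Re _ = complex.Re (c i) * \1_(Ei i) w); last first.
        by case: (c i) => p q /=; rewrite mulr0 subr0.
      over.
    over.
  apply: measurable_sum => i; apply: measurable_funM => //.
have mIm : measurable_fun (Om : set (borelType Gh)) (fun w => complex.Im (f w)).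
  under eq_fun => w.
    rewrite /f /sum_translates Im_sum; under eq_bigr => i _.
      rewrite (_ : complex.Im _ = complex.Im (c i) * \1_(Ei i) w); last first.
        by case: (c i) => p q /=; rewrite mulr0 add0r.
      over.
    over.
  apply: measurable_sum => i; apply: measurable_funM => //.
split=> //.
pose M := \sum_(i < n) sqnormc (c i).
have M0 : 0 <= M by apply: sumr_ge0 => i _; exact: sqnormc_ge0.
apply: (@le_lt_trans _ _ (\int[mu]_(w in (Om : set (borelType Gh))) (cst M%:E w))%E); last first.
  by rewrite integral_cst// lte_mul_pinfty// lee_fin.
apply: ge0_le_integral => //.
- by move=> w _; rewrite lee_fin sqnormc_ge0.
- apply/measurable_EFinP; under eq_fun do rewrite sqnormcE.
  by apply: measurable_funD; exact: measurable_funX.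
move=> w _; rewrite /= lee_fin.
have [[i Eiw]|Nw] := pselect (exists i, Ei i w).
  by rewrite (f_Ei Eiw) /M (bigD1 i)//= lerDl sumr_ge0// => j _; exact: sqnormc_ge0.
rewrite /f /sum_translates big1 ?sqnormcE /= ?expr0n /= ?addr0// => i _.
by rewrite indicE memNset ?mulr0// => Eiw; apply: Nw; exists i.
Qed.

(** On [Ei i], a part of [Om] with the measure of [E], the squared modulus of [f] is the positive
    constant [sqnormc (c i)]. *)
Lemma L2_sqnorm_sum_translates_gt0 i : c i != 0 -> (0 < mu E)%E -> (0 < L2_sqnorm mu Om f)%E.
Proof.
move=> ci0 E0.
have [mRe mIm _] := L2_on_sum_translates.
apply: (@lt_le_trans _ _ (\int[mu]_(w in (Ei i : set (borelType Gh))) (sqnormc (f w))%:E)%E); last first.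
  apply: ge0_subset_integral => //.
  - apply/measurable_EFinP; under eq_fun do rewrite sqnormcE.
    by apply: measurable_funD; exact: measurable_funX.
  - by move=> w _; rewrite lee_fin sqnormc_ge0.
rewrite (_ : (\int[mu]_(w in _) _)%E = (\int[mu]_(w in (Ei i : set (borelType Gh))) (cst (sqnormc (c i))%:E w))%E).
  by rewrite integral_cst// mule_gt0 ?lte_fin ?sqnormc_gt0// muEi.
by apply: eq_integral => w /set_mem /f_Ei ->.
Qed.

End sum_translates.

(** * The multiplicity function as a count *)

(** [F_OmGam] is a supremum of finite partial sums, each counting the elements of a finite part of
    [Gam] that move [w] into [Om]. A partial sum above [k] is at least [k.+1], and the elements it
    counts provide [gam]. *)
Lemma F_OmGam_gt (R : realType) (Gh : zmodType) (Om Gam : set Gh) (w : Gh) (k : nat) :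
  (k%:R%:E < F_OmGam R Om Gam w)%E ->
  (k.+1%:R%:E <= F_OmGam R Om Gam w)%E /\
  exists gam : 'I_k.+1 -> Gh,
    injective gam /\ forall i, Gam (gam i) /\ Om (w + gam i).
Proof.
move=> /ereal_sup_gt[_ [A [finA AGam] <-]].
pose s := [seq x <- fset_set A | w + x \in Om].
have sumE : (\sum_(x \in A) (\1_Om (w + x) : R)%:E)%E = (size s)%:R%:E.
  rewrite fsbig_finite// sumEFin; congr EFin.
  rewrite size_filter -sum1_count natr_sum [RHS]big_mkcond/=.
  by apply: eq_bigr => x _; rewrite indicE; case: ifP.
rewrite sumE lte_fin ltr_nat => ks; split.
  apply: esum_ge; exists A => //.
  by rewrite sumE lee_fin ler_nat.
have us : uniq s by rewrite filter_uniq// fset_uniq.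
have lts (i : 'I_k.+1) : (i < size s)%N by rewrite (leq_trans (ltn_ord i)).
exists (fun i => nth 0 s i); split.
  by move=> i j /eqP; rewrite nth_uniq// => /eqP/val_inj.
move=> i; have := mem_nth 0 (lts i); rewrite mem_filter => /andP[/set_mem Omi].
by rewrite in_fset_set// => /set_mem/AGam.
Qed.

Lemma F_OmGam_ge1 (R : realType) (Gh : zmodType) (Om Gam : set Gh) (w : Gh) :
  Gam 0 -> Om w -> (1 <= F_OmGam R Om Gam w)%E.
Proof.
move=> Gam0 Omw; apply: esum_ge; exists [set 0].
  by split; [exact: finite_set1|move=> _ ->].
by rewrite fsbig_set1 addr0 indicE mem_set.
Qed.

(** * Overlaps of [l.+1] translates are null *)

Lemma overlap_null (R : realType) (G Gh : topologicalZmodType)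
    (e : G -> Gh -> R[i]) (mu : {measure set (borelType Gh) -> \bar R})
    (L : set G) (Om : set Gh) (l : nat) (a : 'I_l -> G) (gam : 'I_l.+1 -> Gh) :
  pontryagin_dual e -> haar_measure mu -> measurable (Om : set (borelType Gh)) ->
  (mu Om < +oo)%E ->
  L2_frame mu Om [set p : 'I_l * G | L p.2] (fun p w => e (a p.1 + p.2) w) ->
  injective gam -> (forall i, annihilator e L (gam i)) ->
  mu.-negligible [set w : borelType Gh | forall i, Om (w + gam i)].
Proof.
move=> pe hmu mOm Omoo [A [B [/andP[A0 _] frame]]] gam_inj gamL.
set D := (X in mu.-negligible X).
have mD : measurable D.
  rewrite (_ : D = \bigcap_(i in [set: 'I_l.+1]) [set w : borelType Gh | Om (w + gam i)]); last first.
    by apply/seteqP; split=> w Dw i *; exact: Dw.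
  apply: fin_bigcap_measurable => [|i _]; first exact: finite_finset.
  by rewrite -[X in measurable X]setTI; exact: measurable_translate.
apply/negligibleP => //; apply/eqP; rewrite -measure_le0 leNgt; apply/negP => D0.
(* Injectivity of [gam] makes these differences nonzero; a set avoiding all of them has disjoint
   translates. *)
pose diffs := [seq gam p.1 - gam p.2 | p <- enum {: 'I_l.+1 * 'I_l.+1} & p.1 != p.2].
have [|E [mE ED E0 Ediff]] := @avoid_translates _ _ _ _ mu diffs D pe _ mD D0.
  apply/mapP => -[[i j]]; rewrite mem_filter /= => /andP[ij _] /esym/eqP.
  by rewrite subr_eq0 => /eqP/gam_inj/eqP; apply/negP.
(* One equation per [a j] in [l.+1] unknowns: the [j]-th one handles all functions [e (a j + g)]
   with [g] in [L]. *)
have [c c0 cM] := left_kernel_wide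
  (\matrix_(i < l.+1, j < l) conjc (e (a j) (gam i)) : 'M[R[i]]_(l.+1, l)).
have [i0 ci0] : exists i, c 0 i != 0.
  apply: contrapT => /forallNP cz; move/eqP: c0; apply; apply/rowP => i.
  by rewrite mxE; apply/eqP/negPn/negP/cz.
have E_Om i w : E w -> Om (w + gam i) by move=> /ED; exact.
(* [E] lies in a translate of [Om], which has the finite measure of [Om]. *)
have Eoo : (mu E < +oo)%E.
  rewrite (le_lt_trans _ Omoo)// -(haar_translate (gam i0) hmu mOm) le_measure ?inE//.
    by rewrite -[X in measurable X]setTI; exact: measurable_translate.
  by move=> w; exact: E_Om.
have E_disj i j : i != j -> forall w, E w -> ~ E (w + (gam i - gam j)).
  move=> ij; apply: Ediff; apply/mapP; exists (i, j) => //.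
  by rewrite mem_filter ij mem_enum.
have := frame _ (L2_on_sum_translates (c 0) mE mOm Omoo E_disj).
(* If all coefficients vanish, the middle term of the frame inequality is 0 while its lower bound is
   positive. The second goal is that they do vanish. *)
rewrite esum1 => [/andP[+ _]|[j g] /= Lg].
  apply/negP; rewrite -ltNge mule_gt0//.
  exact: (L2_sqnorm_sum_translates_gt0 hmu mE mOm Omoo E_Om E_disj ci0 E0).
rewrite L2_inner_sum_translates//.
rewrite (_ : \sum_(i < l.+1) _ = (c *m \matrix_(i, j) conjc (e (a j) (gam i))) 0 j).
  by rewrite cM mxE mul0r sqnormcE /= expr0n addr0.
rewrite mxE; apply: eq_bigr => i _; rewrite mxE; congr (_ * conjc _).
(* The character [gam i] is 1 at [g], so the lattice element drops out of the coefficient. *)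
have [/(_ (gam i))[_ -> _ _] _ _ _ _] := pe.
by rewrite (gamL i g Lg) mulr1.
Qed.

(** * The essential supremum of the multiplicity function *)

Unset Implicit Arguments.
Set Strict Implicit.

Theorem theorem1 (R : realType) (G : topologicalZmodType)
  (Gh : topologicalZmodType)
  (e : G -> Gh -> R[i]) (mu : {measure set (borelType Gh) -> \bar R})
  (L : set G) (Om : set Gh) (l : nat) (a : 'I_l -> G) :
  sc_LCA_group G ->
  pontryagin_dual e ->
  haar_measure mu ->
  uniform_lattice L ->
  measurable (Om : set (borelType Gh)) ->
  (0 < mu Om < +oo)%E ->
  (0 < l)%N ->
  L2_frame mu Om [set p : 'I_l * G | L p.2] (fun p w => e (a p.1 + p.2) w) ->
  exists m : nat, (0 < m <= l)%N /\ subtiling_pair mu Om (annihilator e L) m.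
Proof.
move=> [_ _ scG] pe hmu latL mOm /andP[Om0 Omoo] _ frame.
set Gam := annihilator e L.
pose F := F_OmGam R Om Gam.
have /countable_injP[h h_inj] := annihilator_countable scG pe latL.
have F_le_l : \forall w \ae mu, (F w <= l%:R%:E)%E.
  (* Tuples of annihilator elements are indexed by their codes under [h], which range over a
     countable type. As [h] is injective on [Gam], all points of [A phi] share one tuple, and
     [overlap_null] applies to it. *)
  pose A (phi : {ffun 'I_l.+1 -> nat}) : set (borelType Gh) :=
    [set w | exists gam : 'I_l.+1 -> Gh, [/\ injective gam, forall i, Gam (gam i),
       forall i, h (gam i) = phi i & forall i, Om (w + gam i)]].
  apply: (@negligible_countable_cover _ _ _ mu _ A) => [phi|w /= /negP]; last first.
    rewrite -ltNge => /F_OmGam_gt[_ [gam [gam_inj gamP]]].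
    exists [ffun i => h (gam i)] => //; exists gam; split=> // i; try by case: (gamP i).
    by rewrite ffunE.
  have [[w [gam [gam_inj gamG gamh _]]]|A0] := pselect (A phi !=set0); last first.
    apply: (negligibleS _ (negligible_set0 mu)) => w Aw.
    by apply: A0; exists w.
  apply: (negligibleS _ (overlap_null pe hmu mOm Omoo frame gam_inj gamG)).
  move=> v [gam' [_ gamG' gamh' Omv]] i.
  by have -> : gam i = gam' i by apply: h_inj; [exact/mem_set/gamG|exact/mem_set/gamG'|rewrite gamh gamh'].
have exF : exists k, `[< \forall w \ae mu, (F w <= k%:R%:E)%E >].
  by exists l; apply/asboolP.
(* The multiplicity [m] is the least natural number bounding [F] almost everywhere; it is at most
   [l] by [F_le_l]. *)
have [m /asboolP F_le_m m_min] := ex_minnP exF.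
have m0 : (0 < m)%N.
  (* The term at 0 gives [F >= 1] on [Om], so the bound 0 would make [Om] null. *)
  rewrite lt0n; apply/eqP => m0; move: F_le_m; rewrite m0 => F_le0.
  move: Om0; rewrite lt0e => /andP[/eqP + _]; apply.
  apply/negligibleP => //; apply: negligibleS F_le0 => w Omw /=.
  apply/negP; rewrite -ltNge; apply: lt_le_trans (F_OmGam_ge1 R _ Omw).
    by rewrite lte_fin ltr01.
  by move=> g _; exact: dual0.
exists m; split; first by rewrite m0 m_min//; apply/asboolP.
apply/eqP; rewrite eq_le; apply/andP; split; first exact/ess_supP.
(* An essential supremum below [m] would give [F < m] almost everywhere, hence [F <= m.-1] because
   [F] jumps by whole numbers, against the minimality of [m]. *)
rewrite leNgt; apply/negP => ym.
have := m_min m.-1; rewrite leqNgt prednK// leqnn => /(_ _)/negP; apply => //.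
apply/asboolP; apply: filterS (ess_sup_ge mu F) => w Fy.
rewrite leNgt; apply/negP => /F_OmGam_gt[+ _]; rewrite prednK// leNgt => /negP; apply.
exact: le_lt_trans Fy ym.
Qed.
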